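(* For each integer $k\geq 3$ there is a convexity space $(X,\mathcal{F})$ such that its second Radon number satisfies $r_2=4$, but its $k$-th Radon number satisfies $r_k\geq 3(k-1)+2$.
   Context: A convexity space on a ground set $X$ is a family $\mathcal{F}\subset 2^X$ (whose members are called convex sets) such that $\emptyset\in\mathcal{F}$, $X\in\mathcal{F}$, and the intersection of any collection of members of $\mathcal{F}$ belongs to $\mathcal{F}$. The convex hull $\operatorname{conv} P$ of $P\subset X$ is the intersection of all convex sets containing $P$. The $k$-th Radon number $r_k$ of $(X,\mathcal{F})$ is the minimum natural number, if it exists, such that every set $P\subset X$ with at least $r_k$ points admits a partition $P=P_1\cup\dots\cup P_k$ into $k$ parts with $\operatorname{conv}P_1\cap\dots\cap\operatorname{conv}P_k\neq\emptyset$. *)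

(* Defs.v *)
From mathcomp Require Import all_boot.
From mathcomp Require Import all_classical.

Set Implicit Arguments.
Unset Strict Implicit.
Unset Printing Implicit Defensive.

Local Open Scope classical_set_scope.
Local Open Scope card_scope.

(* The ground set is the whole type X. *)
Definition convexity_space (X : Type) (F : set (set X)) : Prop :=
  [/\ F set0, F setT
    & forall G : set (set X), G `<=` F -> F (\bigcap_(A in G) A)].

(* [smallest F P] is the intersection of all members of F that contain P. *)
Definition conv (X : Type) (F : set (set X)) (P : set X) : set X :=
  smallest F P.

(* The parts of a [partition] are nonempty; as the hull of the empty set is
   empty in a convexity space, this is forced by the condition on the hulls. *)
Definition radon_property (X : Type) (F : set (set X)) (k r : nat) : Prop :=
  forall P : set X, `I_r #<= P ->
    exists Q : 'I_k -> set X,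
      classical_sets.partition [set: 'I_k] Q P /\
      \bigcap_(i in [set: 'I_k]) conv F (Q i) !=set0.

(* The k-th Radon number of F exists and equals r. *)
Definition is_radon_number (X : Type) (F : set (set X)) (k r : nat) : Prop :=
  radon_property F k r /\ forall m : nat, radon_property F k m -> r <= m.

(* Main.v *)
(* Let P be a set of 3(k-1)+1 points.  A point of the convexity space is encoded
   by a family of subsets of P, namely those sets whose hull is to contain it,
   and conv A consists of the points whose family contains every set common to
   the families of the points of A.  Besides the points p of P (all sets through
   p) there are, for each a in P, the star of a (all sets of size at least 3 and
   all pairs through a) and, for each pair M of disjoint edges, the family of M
   (all sets of size at least 4, all sets containing an edge of M, and certain
   triples meeting an edge of M).  No family contains k disjoint sets: such sets
   would have total size at least 3k-2 = |P|, with equality only for the two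
   edges of M together with k-2 triples, and each triple of the family of M meets
   an edge of M.  Hence P has no partition into k parts with intersecting hulls.

   For four points A, B, C, D one looks for a point whose family contains
   (A /\ B) \/ (C /\ D) or A \/ (B /\ C /\ D), up to order.  Stars suffice as soon
   as the pairs in such a combination share a vertex.  The only real obstruction
   is three matchings {e, as1}, {e, as2}, {e, as3}.  It is removed by placing P on
   a circle and admitting a triple T meeting an edge vw only in v exactly when T
   lies on the arc from v to w: if s3 is the last of the s_i after a, then the
   first two families meet inside the third. *)
Require Import Defs.
From mathcomp Require Import all_boot.
From mathcomp Require Import zify.

Set Implicit Arguments.
Unset Strict Implicit.
Unset Printing Implicit Defensive.

(** * Cyclic order of points on a circle *)

Definition cyc (x y z : nat) := [|| x < y < z, y < z < x | z < x < y].

Lemma cyc12 x y : cyc x x y = false. Proof. rewrite /cyc; lia. Qed.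
Lemma cyc13 x y : cyc x y x = false. Proof. rewrite /cyc; lia. Qed.

Lemma cyc_swap x y z : cyc x y z -> cyc y x z = false.
Proof. rewrite /cyc; lia. Qed.

(** Cutting the circle at [a] turns [cyc a] into a strict linear order, total on the points other
    than [a] by [cyc_total]; this gives sense to the last of several points after [a]. *)
Lemma cyc_trans a y x z : cyc a x y -> cyc a y z -> cyc a x z.
Proof. rewrite /cyc; lia. Qed.

Lemma cyc_total a x y : a != x -> a != y -> x != y -> cyc a x y || cyc a y x.
Proof. rewrite /cyc; lia. Qed.

(** * Points as families of subsets, and splits of a list of points *)

Section Points.
Variable n : nat.
Implicit Types (p q r a v w x y z : 'I_n) (e f g S : {set 'I_n}).
Implicit Types (M : {set {set 'I_n}}).

Definition two_matching M :=
  [&& #|M| == 2, [forall e in M, #|e| == 2] & trivIset M].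

(* [S] lies on the half-open arc from [v] (included, and in [S]) to [w]. *)
Definition in_arc v w S := (v \in S) && [forall y in S :\ v, cyc v y w].

Definition through p : {set {set 'I_n}} := [set S : {set 'I_n} | p \in S].
Definition star a : {set {set 'I_n}} :=
  [set S : {set 'I_n} | (1 < #|S|) && ((a \in S) || (2 < #|S|))].
(** Letting [v] and [w] range freely over [e] gives both orientations of the arc; the choice [v = w]
    adds no triple, since [cyc v y v] is false. *)
Definition chord e S :=
  (e \subset S)
  || (#|S| == 3) && [exists v in e, exists w in e, in_arc v w S].

Definition chords M : {set {set 'I_n}} :=
  [set S : {set 'I_n} | (3 < #|S|) || [exists e in M, chord e S]].

Definition carrier := ('I_n + 'I_n + {M | two_matching M})%type.

Definition fam (u : carrier) : {set {set 'I_n}} :=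
  match u with
  | inl (inl p) => through p
  | inl (inr a) => star a
  | inr M => chords (val M)
  end.

(* The family of the witness [u] contains all sets common to [s1] and all sets
   common to [s2], so [u] lies in both hulls. *)
Definition radon_split (s : seq carrier) : Prop :=
  exists (u : carrier) (s1 s2 : seq carrier),
    [/\ perm_eq (s1 ++ s2) s, s1 != [::], s2 != [::]
      & forall S, all (fun t => S \in fam t) s1 || all (fun t => S \in fam t) s2 ->
                  S \in fam u].

Lemma radon_split_perm s1 s2 :
  perm_eq s1 s2 -> radon_split s1 -> radon_split s2.
Proof.
move=> s12 [u [t1 [t2 [pt n1 n2 h]]]].
by exists u, t1, t2; split=> //; apply: perm_trans s12.
Qed.

Lemma radon_split13 A B C D :
  (forall S, S \in fam B -> S \in fam C -> S \in fam D -> S \in fam A) ->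
  radon_split [:: A; B; C; D].
Proof.
move=> h; exists A, [:: A], [:: B; C; D]; split=> // S /=.
by rewrite !andbT => /orP[//|/and3P[]]; apply: h.
Qed.

Lemma radon_split22 (U A B C D : carrier) :
  (forall S, S \in fam A -> S \in fam B -> S \in fam U) ->
  (forall S, S \in fam C -> S \in fam D -> S \in fam U) ->
  radon_split [:: A; B; C; D].
Proof.
move=> h1 h2; exists U, [:: A; B], [:: C; D]; split=> // S /=.
by rewrite !andbT => /orP[] /andP[]; [apply: h1|apply: h2].
Qed.

Lemma starI a S : 1 < #|S| -> (#|S| = 2 -> a \in S) -> S \in star a.
Proof.
move=> S1 h; rewrite inE S1 /=; case: ltnP => [|S2]; rewrite ?orbT // orbF.
by apply: h; apply/eqP; rewrite eqn_leq S2.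
Qed.

Lemma star_gt1 a S : S \in star a -> 1 < #|S|.
Proof. by rewrite inE => /andP[]. Qed.

Lemma star2 a S : S \in star a -> #|S| = 2 -> a \in S.
Proof. by rewrite inE => /andP[_] /orP[//|]; case: #|S| => [|[|[]]]. Qed.

Lemma through2_gt1 p q S : p != q -> p \in S -> q \in S -> 1 < #|S|.
Proof.
move=> pq pS qS; have <- : #|[set p; q]| = 2 by rewrite cards2 pq.
by apply/subset_leq_card/subsetP => x /set2P[]->.
Qed.

Lemma edge_set2 p q e : #|e| = 2 -> p != q -> p \in e -> q \in e ->
  e = [set p; q].
Proof.
move=> e2 pq pe qe; apply/esym/eqP; rewrite eqEcard cards2 pq e2 andbT.
by apply/subsetP => x /set2P[]->.
Qed.

(** * Edges of a matching and the pairs in its family *)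

Section Matching.
Variable M : {set {set 'I_n}}.
Hypothesis MM : two_matching M.

Lemma card_edge e : e \in M -> #|e| = 2.
Proof. by case/and3P: MM => _ /forall_inP h _ /h/eqP. Qed.

Lemma edge_inj e f x : e \in M -> f \in M -> x \in e -> x \in f -> e = f.
Proof.
case/and3P: MM => _ _ /trivIsetP h eM fM xe xf; apply/eqP/negPn/negP => ef.
by have /disjoint_setI0 /setP/(_ x) := h _ _ eM fM ef; rewrite !inE xe xf.
Qed.

Lemma edge_cover e f g : e \in M -> f \in M -> e != f -> g \in M ->
  g = e \/ g = f.
Proof.
move=> eM fM ef gM; suff: g \in [set e; f] by case/set2P; [left|right].
suff -> : [set e; f] = M by [].
case/and3P: MM => /eqP M2 _ _; apply/eqP; rewrite eqEcard cards2 ef M2 andbT.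
by apply/subsetP => x /set2P[]->.
Qed.

Lemma chords_chord e S : e \in M -> chord e S -> S \in chords M.
Proof. by move=> eM eS; rewrite inE; apply/orP; right; apply/exists_inP; exists e. Qed.

Lemma chords_edge e S : e \in M -> e \subset S -> S \in chords M.
Proof. by move=> eM eS; apply: (chords_chord eM); rewrite /chord eS. Qed.

Lemma chords_gt1 S : S \in chords M -> 1 < #|S|.
Proof.
rewrite inE => /orP[|/exists_inP[e eM /orP[/subset_leq_card|/andP[/eqP->]]]] //.
  by case: #|S| => [|[]].
by rewrite (card_edge eM).
Qed.

(** A pair is too small for the size clause and for the triple clause, so it contains an edge and
    equals it. *)
Lemma chords2 S : S \in chords M -> #|S| = 2 -> S \in M.
Proof.
rewrite inE => + S2; rewrite S2 /= => /exists_inP[e eM].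
rewrite /chord S2 orbF => eS; suff <- : e = S by [].
by apply/eqP; rewrite eqEcard eS S2 (card_edge eM).
Qed.

End Matching.

(** Two different common edges would exhaust both matchings and make them equal. *)
Lemma common_edge M N e f : two_matching M -> two_matching N -> M != N ->
  e \in M -> e \in N -> f \in M -> f \in N -> e = f.
Proof.
move=> MM NN MN eM eN fM fN; apply/eqP/negPn/negP => ef.
case/negP: MN; apply/eqP/setP => g; apply/idP/idP => gM.
  by case: (edge_cover MM eM fM ef gM) => ->.
by case: (edge_cover NN eN fN ef gM) => ->.
Qed.

(** * Triples on arcs, and three matchings with a common edge *)

Lemma in_arcP v w S :
  reflect (v \in S /\ forall y, y \in S -> y != v -> cyc v y w) (in_arc v w S).
Proof.
apply: (iffP andP) => -[vS h]; split=> //.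
  by move=> y yS yv; move/forall_inP: h; apply; rewrite !inE yv.
by apply/forall_inP => y; rewrite !inE => /andP[yv yS]; apply: h.
Qed.

Lemma chord_set2P a s S : #|S| = 3 -> chord [set a; s] S ->
  [\/ a \in S /\ s \in S, in_arc a s S | in_arc s a S].
Proof.
move=> S3 /orP[/subsetP h|]; first by apply: Or31; rewrite !h // !inE eqxx ?orbT.
have no_loop v : ~~ in_arc v v S.
  apply/negP => /in_arcP[vS h]; have : S :\ v != set0.
    by by rewrite -card_gt0; have := cardsD1 v S; rewrite S3 vS add1n => -[<-].
  case/set0Pn => y; rewrite !inE => /andP[yv yS].
  by have := h y yS yv; rewrite cyc13.
case/andP=> _ /exists_inP[v /set2P[]-> /exists_inP[w /set2P[]->]] h;
  rewrite ?(negPf (no_loop _)) in h => //; by [apply: Or32|apply: Or33].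
Qed.

(* Triples through [a] in the first two families lie on the arc up to the later
   of [s1], [s2]; a triple avoiding [a] would contain [s1] and [s2] and lie on the
   arcs from [s1] to [a] and from [s2] to [a], which is impossible. *)
Lemma chords_meet M1 M2 M3 e a s1 s2 s3 :
    two_matching M1 -> two_matching M2 ->
    e \in M1 -> e \in M2 -> e \in M3 -> a \notin e ->
    [set a; s1] \in M1 -> [set a; s2] \in M2 -> [set a; s3] \in M3 ->
    s1 != s2 -> cyc a s1 s3 -> cyc a s2 s3 ->
  forall S, S \in chords M1 -> S \in chords M2 -> S \in chords M3.
Proof.
move=> MM1 MM2 e1 e2 e3 ae f1 f2 f3 s12 as13 as23 S S1 S2.
have [S4|] := ltnP 3 #|S|; first by rewrite inE S4.
have := chords_gt1 MM1 S1; case Sn: #|S| => [|[|[|[|]]]] // _ _.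
  (* A pair lies in both matchings, so it is [e] or equals both [[set a; s1]] and [[set a; s2]]; the
     latter is impossible. *)
  have {}S1 := chords2 MM1 S1 Sn; have {}S2 := chords2 MM2 S2 Sn.
  have ef i : e != [set a; i] by apply: contraNneq ae => ->; rewrite !inE eqxx.
  case: (edge_cover MM1 e1 f1 (ef _) S1) => SE.
    by apply: (chords_edge e3); rewrite SE.
  case: (edge_cover MM2 e2 f2 (ef _) S2) => SE'.
    by apply: (chords_edge e3); rewrite SE'.
  have : s1 \in [set a; s2] by rewrite -SE' SE !inE eqxx orbT.
  rewrite !inE (negPf s12) orbF => /eqP sa.
  by move: as13; rewrite sa cyc12.
have near M s : two_matching M -> e \in M -> [set a; s] \in M ->
    S \in chords M -> chord e S \/ chord [set a; s] S.
  move=> MM eM fM; rewrite inE Sn /= => /exists_inP[g gM gS].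
  have ef : e != [set a; s] by apply: contraNneq ae => ->; rewrite !inE eqxx.
  by case: (edge_cover MM eM fM ef gM) => <-; [left|right].
have [/(chords_chord e3)//|/(chord_set2P Sn) near1] := near _ _ MM1 e1 f1 S1.
have [/(chords_chord e3)//|/(chord_set2P Sn) near2] := near _ _ MM2 e2 f2 S2.
apply: (chords_chord f3); rewrite /chord Sn eqxx /=.
have [aS|aS] := boolP (a \in S).
  have [s3S|s3S] := boolP (s3 \in S).
    by apply/orP; left; apply/subsetP => x /set2P[]->.
  apply/orP; right; apply/exists_inP; exists a; rewrite ?inE ?eqxx //.
  apply/exists_inP; exists s3; rewrite ?inE ?eqxx ?orbT //.
  apply/in_arcP; split=> // y yS ya.
  have far s : [\/ a \in S /\ s \in S, in_arc a s S | in_arc s a S] ->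
      cyc a s s3 -> s \in S \/ cyc a y s3.
    case=> [[]|/in_arcP[_ h]|/in_arcP[sS h]] asx; [by left|right|by left].
    exact: (cyc_trans (h y yS ya) asx).
  have [s1S|//] := far _ near1 as13; have [s2S|//] := far _ near2 as23.
  have s1a : s1 != a by apply: contraTneq as13 => ->; rewrite cyc12.
  have s2a : s2 != a by apply: contraTneq as23 => ->; rewrite cyc12.
  have SE : [set a; s1; s2] = S.
    apply/eqP; rewrite eqEcard Sn; apply/andP; split.
      by apply/subsetP => x; rewrite !inE => /orP[/orP[]|] /eqP->.
    by rewrite setUC cardsU1 cards2 !inE negb_or s2a eq_sym s12 eq_sym s1a.
  by move: yS; rewrite -SE !inE (negPf ya) /= => /orP[] /eqP->.
case: near1 => [[]|/in_arcP[]|/in_arcP[s1S h1]]; rewrite ?(negPf aS) //.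
case: near2 => [[]|/in_arcP[]|/in_arcP[s2S h2]]; rewrite ?(negPf aS) //.
have s21 : s2 != s1 by rewrite eq_sym.
by have := h2 _ s1S s12; rewrite (cyc_swap (h1 _ s2S s21)).
Qed.

(** * Splits witnessed by a star *)

Local Notation pt p := (inl (inl p) : carrier).
Local Notation st a := (inl (inr a) : carrier).
Local Notation ch M := (inr M : carrier).
Implicit Types (G H K L : {M | two_matching M}).

Lemma fam_pt p S : (S \in fam (pt p)) = (p \in S).
Proof. by rewrite /= inE. Qed.

Lemma fam_ch G S : (S \in fam (ch G)) = (S \in chords (val G)).
Proof. by []. Qed.

(* Pinning both halves of a split at [a] makes the star of [a] a witness. *)
Definition pinned a (u t : carrier) := forall S, S \in fam u -> S \in fam t ->
  1 < #|S| /\ (#|S| = 2 -> a \in S).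

Lemma radon_split_star a A B C D : pinned a A B -> pinned a C D ->
  radon_split [:: A; B; C; D].
Proof.
move=> h1 h2; apply: (radon_split22 (U := st a)) => S.
  by move=> SA SB; case: (h1 S SA SB); apply: starI.
by move=> SC SD; case: (h2 S SC SD); apply: starI.
Qed.

Lemma pinned_ptl p q : p != q -> pinned p (pt p) (pt q).
Proof.
move=> pq S; rewrite !fam_pt => pS qS; split=> //.
exact: (through2_gt1 pq pS qS).
Qed.

Lemma pinned_ptr p q : p != q -> pinned q (pt p) (pt q).
Proof.
move=> pq S; rewrite !fam_pt => pS qS; split=> //.
exact: (through2_gt1 pq pS qS).
Qed.

Lemma pinned_pt_st p a : pinned p (pt p) (st a).
Proof. by move=> S; rewrite fam_pt => pS aS; split; rewrite ?(star_gt1 aS). Qed.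

(** By [chords2] the pairs in the family of [G] are edges, so only the edges lying in the family of
    [u] have to pass through [a]. *)
Lemma pinned_ch a u G :
  (forall e, e \in val G -> e \in fam u -> a \in e) -> pinned a u (ch G).
Proof.
move=> h S Su; rewrite fam_ch => SG; split; first exact: (chords_gt1 (valP G)).
by move=> S2; apply: h Su; exact: (chords2 (valP G) SG S2).
Qed.

Lemma pinned_pt_ch p G : pinned p (pt p) (ch G).
Proof. by apply: pinned_ch => e _; rewrite fam_pt. Qed.

Lemma pinned_common a G H :
  (forall e, e \in val G -> e \in val H -> a \in e) -> pinned a (ch G) (ch H).
Proof.
move=> h; apply: pinned_ch => e eH; rewrite fam_ch => eG; apply: (h e _ eH).
exact: (chords2 (valP G) eG (card_edge (valP H) eH)).
Qed.

Definition misses p G := forall e, e \in val G -> p \notin e.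

Lemma missesP p G : misses p G \/ exists2 e, e \in val G & p \in e.
Proof.
have [/exists_inP[e eG pe]|/exists_inPn h] := boolP [exists e in val G, p \in e].
  by right; exists e.
by left.
Qed.

(** No edge of [G] passes through [p], so the two families share no pair and every [a] is
    allowed. *)
Lemma pinned_misses a p G : misses p G -> pinned a (pt p) (ch G).
Proof.
by move=> h; apply: pinned_ch => e /h/negPf pe; rewrite fam_pt pe.
Qed.

Lemma commonP G H : (val G :&: val H = set0) \/ exists2 e, e \in val G & e \in val H.
Proof.
have [|[e]] := set_0Vmem (val G :&: val H); first by left.
by rewrite inE => /andP[eG eH]; right; exists e.
Qed.

Lemma pinned_disjoint a G H : val G :&: val H = set0 -> pinned a (ch G) (ch H).
Proof.
move=> GH; apply: pinned_common => e eG eH.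
by have := in_set0 e; rewrite -GH inE eG eH.
Qed.

Lemma pinned_common_edge a G H e : G != H -> e \in val G -> e \in val H ->
  a \in e -> pinned a (ch G) (ch H).
Proof.
move=> GH eG eH ae; apply: pinned_common => f fG fH.
suff -> : f = e by [].
by apply: (common_edge (valP G) (valP H)); rewrite ?(inj_eq val_inj).
Qed.

(** * The fifteen kinds of quadruples of points *)

Ltac reorder s :=
  apply: (@radon_split_perm s); [by apply/permP => ? /=; clear; lia|].

(* In the names [split_xyzw], the letters p, s and c stand for a point of the
   ground set, a star and the family of a matching. *)
Lemma split_pppp p q r s : p != q -> p != r -> p != s -> q != r -> q != s ->
  r != s -> radon_split [:: pt p; pt q; pt r; pt s].
Proof.
move=> pq pr ps qr qs rs.
(* The witness is the matching whose edges are the two pairs of points. *)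
pose M := [set [set p; q]; [set r; s]].
have d : [disjoint [set p; q] & [set r; s]].
  rewrite -setI_eq0; apply/eqP/setP => x; rewrite !inE.
  by case: eqVneq => [->|_]; [rewrite (negPf pr) (negPf ps)
    |case: eqVneq => // ->; rewrite (negPf qr) (negPf qs)].
have MM : two_matching M.
  apply/and3P; split.
  - rewrite cards2; suff -> : [set p; q] != [set r; s] by [].
    apply/eqP => /setP/(_ p); rewrite !inE eqxx.
    by rewrite (negPf pr) (negPf ps).
  - by apply/forall_inP => e /set2P[]->; rewrite cards2 ?pq ?rs.
  - apply/trivIsetP => e f /set2P[]-> /set2P[]->; rewrite ?eqxx //.
    by rewrite disjoint_sym.
apply: (radon_split22 (U := ch (exist _ M MM))) => S; rewrite !fam_pt => xS yS.
  apply: (@chords_edge M [set p; q]); rewrite ?inE ?eqxx //.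
  by apply/subsetP => x /set2P[]->.
apply: (@chords_edge M [set r; s]); rewrite ?inE ?eqxx ?orbT //.
by apply/subsetP => x /set2P[]->.
Qed.

Lemma card_gt2 p q r S : p != q -> p != r -> q != r ->
  p \in S -> q \in S -> r \in S -> 2 < #|S|.
Proof.
move=> pq pr qr pS qS rS; have <- : #|[set p; q; r]| = 3.
  by rewrite setUC cardsU1 cards2 pq !inE negb_or eq_sym pr eq_sym qr.
by apply/subset_leq_card/subsetP => x /setUP[/set2P[]|/set1P] ->.
Qed.

(** A set through three distinct points has size at least 3, hence lies in every star. *)
Lemma split_ppps p q r a : p != q -> p != r -> q != r ->
  radon_split [:: pt p; pt q; pt r; st a].
Proof.
move=> pq pr qr; reorder [:: st a; pt p; pt q; pt r].
apply: radon_split13 => S; rewrite !fam_pt => pS qS rS.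
have := card_gt2 pq pr qr pS qS rS.
by move=> S2; apply: starI => [|S2']; [apply: ltnW|rewrite S2' in S2].
Qed.

Lemma split_pp_edge p q A G e : p != q -> e \in val G -> p \in e -> q \in e ->
  radon_split [:: ch G; pt p; pt q; A].
Proof.
move=> pq eG pe qe; apply: radon_split13 => S; rewrite !fam_pt => pS qS _.
apply: (chords_edge eG).
by rewrite (edge_set2 (card_edge (valP G) eG) pq pe qe); apply/subsetP => x /set2P[]->.
Qed.

(** If [G] misses one of the points, that point is paired with [G] and a star at another point is
    the witness. Otherwise two of the three points span an edge of [G], and [G] is the witness. *)
Lemma split_pppc p q r G : p != q -> p != r -> q != r ->
  radon_split [:: pt p; pt q; pt r; ch G].
Proof.
move=> pq pr qr.
have [h|[e eG pe]] := missesP p G.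
  reorder [:: pt q; pt r; pt p; ch G].
  by apply: (radon_split_star (a := q)); [apply: pinned_ptl|apply: pinned_misses].
have [h|[f fG qf]] := missesP q G.
  reorder [:: pt p; pt r; pt q; ch G].
  by apply: (radon_split_star (a := p)); [apply: pinned_ptl|apply: pinned_misses].
have [h|[g gG rg]] := missesP r G.
  by apply: (radon_split_star (a := p)); [apply: pinned_ptl|apply: pinned_misses].
have [ef|ef] := eqVneq e f.
  by reorder [:: ch G; pt p; pt q; pt r]; apply: (split_pp_edge _ pq eG pe); rewrite ef.
case: (edge_cover (valP G) eG fG ef gG) => gE; rewrite gE in rg.
  by reorder [:: ch G; pt p; pt r; pt q]; apply: (split_pp_edge _ pr eG pe).
by reorder [:: ch G; pt q; pt r; pt p]; apply: (split_pp_edge _ qr fG qf).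
Qed.

(** The only pair to control is [e]: if it contains [a], the star of [a] is the witness; if not, the
    star of [a] excludes [e] and the star of [b] is the witness. *)
Lemma split_ppss p q a b : p != q -> a != b ->
  radon_split [:: pt p; pt q; st a; st b].
Proof.
move=> pq ab; pose e := [set p; q].
have target c A : (c \in e) || (e \notin fam A) ->
    radon_split [:: st c; A; pt p; pt q].
  move=> ce; apply: radon_split13 => S SA; rewrite !fam_pt => pS qS.
  apply: starI => [|S2]; first exact: (through2_gt1 pq pS qS).
  have SE : S = e by apply: edge_set2.
  by move: ce; rewrite -SE SA orbF.
have [ae|ae] := boolP (a \in e).
  by reorder [:: st a; st b; pt p; pt q]; apply: target; rewrite ae.
reorder [:: st b; st a; pt p; pt q]; apply: target; apply/orP; right.
by apply: contra ae => /star2; apply; rewrite cards2 pq.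
Qed.

Lemma split_ppsc p q a G : p != q ->
  radon_split [:: pt p; pt q; st a; ch G].
Proof.
move=> pq; have [eG|eG] := boolP ([set p; q] \in val G).
  reorder [:: ch G; pt p; pt q; st a].
  by apply: (split_pp_edge _ pq eG); rewrite !inE eqxx ?orbT.
reorder [:: st a; ch G; pt p; pt q].
apply: radon_split13 => S; rewrite fam_ch !fam_pt => SG pS qS.
apply: starI => [|S2]; first exact: (through2_gt1 pq pS qS).
by case/negP: eG; rewrite -(edge_set2 S2 pq pS qS); exact: (chords2 (valP G) SG S2).
Qed.

(** In the remaining case [p] and [q] lie on different edges of [G], so an edge shared with [H]
    passes through one of them, and the star there is the witness. *)
Lemma split_ppcc p q G H : p != q -> G != H ->
  radon_split [:: pt p; pt q; ch G; ch H].
Proof.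
move=> pq GH; have [eG|eG] := boolP ([set p; q] \in val G).
  reorder [:: ch G; pt p; pt q; ch H].
  by apply: (split_pp_edge _ pq eG); rewrite !inE eqxx ?orbT.
have [h|[e eG' pe]] := missesP p G.
  reorder [:: pt p; ch G; pt q; ch H].
  by apply: (radon_split_star (a := q)); [apply: pinned_misses|apply: pinned_pt_ch].
have [h|[f fG qf]] := missesP q G.
  reorder [:: pt q; ch G; pt p; ch H].
  by apply: (radon_split_star (a := p)); [apply: pinned_misses|apply: pinned_pt_ch].
have ef : e != f.
  apply: contraNneq eG => ef; rewrite -(edge_set2 (card_edge (valP G) eG') pq pe) //.
  by rewrite ef.
have [h|[g gG gH]] := commonP G H.
  by apply: (radon_split_star (a := p)); [apply: pinned_ptl|apply: pinned_disjoint].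
case: (edge_cover (valP G) eG' fG ef gG) => gE.
  apply: (radon_split_star (a := p)); first exact: pinned_ptl.
  by apply: (pinned_common_edge GH gG gH); rewrite gE.
apply: (radon_split_star (a := q)); first exact: pinned_ptr.
by apply: (pinned_common_edge GH gG gH); rewrite gE.
Qed.

Lemma big_st a S : S \in fam (st a) -> 1 < #|S|.
Proof. exact: star_gt1. Qed.

Lemma big_ch G S : S \in fam (ch G) -> 1 < #|S|.
Proof. exact: (chords_gt1 (valP G)). Qed.

Lemma radon_split13_star a B C D : (forall S, S \in fam D -> 1 < #|S|) ->
  (forall S, #|S| = 2 -> S \in fam B -> S \in fam C -> S \in fam D -> a \in S) ->
  radon_split [:: st a; B; C; D].
Proof.
move=> bigD h; apply: radon_split13 => S SB SC SD.
by apply: starI (bigD S SD) _ => S2; apply: h.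
Qed.

Lemma star_mem a S : #|S| = 2 -> S \in fam (st a) -> a \in S.
Proof. by move=> S2 aS; apply: star2 aS S2. Qed.

Lemma chords_mem G S : #|S| = 2 -> S \in fam (ch G) -> S \in val G.
Proof. by move=> S2 GS; apply: (chords2 (valP G) GS S2). Qed.

Lemma split_psss p a b c : a != b -> a != c -> b != c ->
  radon_split [:: pt p; st a; st b; st c].
Proof.
move=> ab ac bc.
have centre x y z : p = x -> radon_split [:: st x; pt p; st y; st z].
  move=> <-; apply: radon_split13_star => [S|S _]; first exact: big_st.
  by rewrite fam_pt.
have [/centre h|pb] := eqVneq p b.
  by reorder [:: st b; pt p; st a; st c].
have [/centre h|pc] := eqVneq p c.
  by reorder [:: st c; pt p; st a; st b].
reorder [:: st a; pt p; st b; st c].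
apply: radon_split13_star => [S|S S2]; first exact: big_st.
rewrite fam_pt => pS /(star_mem S2) bS /(star_mem S2) cS.
by have := card_gt2 pb pc bc pS bS cS; rewrite S2.
Qed.

(** The disjoint edges of [G] cannot include both [[set p; a]] and [[set p; b]]; the star opposite
    to an absent one is the witness. *)
Lemma split_pssc p a b G : a != b ->
  radon_split [:: pt p; st a; st b; ch G].
Proof.
move=> ab.
have away x y : p = x \/ p != y /\ [set p; y] \notin val G ->
    radon_split [:: st x; pt p; st y; ch G].
  move=> h; apply: radon_split13_star => [S|S S2]; first exact: big_ch.
  rewrite fam_pt => pS /(star_mem S2) yS /(chords_mem S2) SG.
  case: h => [<-//|[py /negP[]]].
  by rewrite -(edge_set2 S2 py pS yS).
have [pa|pa] := eqVneq p a.
  by reorder [:: st a; pt p; st b; ch G]; apply: away; left.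
have [pb|pb] := eqVneq p b.
  by reorder [:: st b; pt p; st a; ch G]; apply: away; left.
have [paG|paG] := boolP ([set p; a] \in val G); last first.
  by reorder [:: st b; pt p; st a; ch G]; apply: away; right.
reorder [:: st a; pt p; st b; ch G]; apply: away; right; split=> //.
apply/negP => pbG; have : [set p; a] = [set p; b].
  by apply: (edge_inj (valP G) paG pbG (x := p)); rewrite !inE eqxx.
move/setP/(_ a); rewrite !inE eqxx orbT (negPf ab) orbF.
by rewrite eq_sym (negPf pa).
Qed.

Lemma split_pscc p a G H : G != H ->
  radon_split [:: pt p; st a; ch G; ch H].
Proof.
move=> GH.
have [h|[e eG eH]] := commonP G H.
  reorder [:: st a; pt p; ch G; ch H].
  apply: radon_split13_star => [S|S S2 _]; first exact: big_ch.
  move=> /(chords_mem S2) SG /(chords_mem S2) SH.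
  by have := in_set0 S; rewrite -h inE SG SH.
have [pe|pe] := boolP (p \in e).
  apply: (radon_split_star (a := p)); first exact: pinned_pt_st.
  exact: (pinned_common_edge GH eG eH).
reorder [:: st a; pt p; ch G; ch H].
apply: radon_split13_star => [S|S S2]; first exact: big_ch.
rewrite fam_pt => pS /(chords_mem S2) SG /(chords_mem S2) SH.
case/negP: pe; suff -> : e = S by [].
by apply: (common_edge (valP G) (valP H)); rewrite ?(inj_eq val_inj).
Qed.

Lemma pinned_some p G H : G != H -> exists a, pinned a (ch G) (ch H).
Proof.
move=> GH; have [h|[e eG eH]] := commonP G H.
  by exists p; apply: pinned_disjoint.
have /card_gt0P[a ae] : 0 < #|e| by rewrite (card_edge (valP G) eG).
by exists a; apply: pinned_common_edge GH eG eH ae.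
Qed.

Lemma edge_other a f G : f \in val G -> a \in f ->
  exists2 s, a != s & f = [set a; s].
Proof.
move=> fG af; have := cardsD1 a f; rewrite (card_edge (valP G) fG) af add1n => -[].
move/esym/eqP/cards1P => [s fs]; exists s; last by rewrite -(setD1K af) fs.
by have := set11 s; rewrite -fs !inE eq_sym => /andP[].
Qed.

(** As the matchings differ, so do the second endpoints [s1], [s2], [s3] of the edges at [a]. By
    [chords_meet] the matching of the last one after [a] is a witness against the other two, which
    [A] may join. *)
Lemma split_concurrent A G H K e f1 f2 f3 a : G != H -> G != K -> H != K ->
    e \in val G -> e \in val H -> e \in val K -> a \notin e ->
    f1 \in val G -> f2 \in val H -> f3 \in val K ->
    a \in f1 -> a \in f2 -> a \in f3 ->
  radon_split [:: A; ch G; ch H; ch K].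
Proof.
move=> GH GK HK eG eH eK ae f1G f2H f3K af1 af2 af3.
have ne L L' s t : L != L' -> e \in val L -> e \in val L' ->
    [set a; s] \in val L -> [set a; t] \in val L' -> s != t.
  move=> LL' eL eL' sL tL'; apply: contraNneq ae => st.
  suff -> : e = [set a; s] by rewrite !inE eqxx.
  by apply: (common_edge (valP L) (valP L')); rewrite ?(inj_eq val_inj) // st.
have [s1 as1 E1] := edge_other f1G af1; have [s2 as2 E2] := edge_other f2H af2.
have [s3 as3 E3] := edge_other f3K af3.
rewrite {}E1 in f1G af1; rewrite {}E2 in f2H af2; rewrite {}E3 in f3K af3.
have s12 := ne _ _ _ _ GH eG eH f1G f2H.
have s13 := ne _ _ _ _ GK eG eK f1G f3K.
have s23 := ne _ _ _ _ HK eH eK f2H f3K.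
have last3 G1 G2 G3 t1 t2 t3 :
    e \in val G1 -> e \in val G2 -> e \in val G3 ->
    [set a; t1] \in val G1 -> [set a; t2] \in val G2 -> [set a; t3] \in val G3 ->
    t1 != t2 -> cyc a t1 t3 -> cyc a t2 t3 ->
    radon_split [:: ch G3; ch G1; ch G2; A].
  move=> e1 e2 e3 t1G t2G t3G t12 c13 c23; apply: radon_split13 => S S1 S2 _.
  exact: (chords_meet (valP G1) (valP G2) e1 e2 e3 ae t1G t2G t3G t12 c13 c23 S1 S2).
have s21 : s2 != s1 by rewrite eq_sym.
have s31 : s3 != s1 by rewrite eq_sym.
have s32 : s3 != s2 by rewrite eq_sym.
have [c12|c21] := orP (cyc_total as1 as2 s12).
  have [c23|c32] := orP (cyc_total as2 as3 s23).
    reorder [:: ch K; ch G; ch H; A].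
    exact: (last3 _ _ _ _ _ _ eG eH eK f1G f2H f3K s12 (cyc_trans c12 c23) c23).
  reorder [:: ch H; ch G; ch K; A].
  exact: (last3 _ _ _ _ _ _ eG eK eH f1G f3K f2H s13 c12 c32).
have [c13|c31] := orP (cyc_total as1 as3 s13).
  reorder [:: ch K; ch G; ch H; A].
  exact: (last3 _ _ _ _ _ _ eG eH eK f1G f2H f3K s12 c13 (cyc_trans c21 c13)).
reorder [:: ch G; ch H; ch K; A].
exact: (last3 _ _ _ _ _ _ eH eK eG f2H f3K f1G s23 c21 c31).
Qed.

Lemma split_pccc p G H K : G != H -> G != K -> H != K ->
  radon_split [:: pt p; ch G; ch H; ch K].
Proof.
move=> GH GK HK.
have easy L1 L2 L3 : L2 != L3 ->
    radon_split [:: pt p; ch L1; ch L2; ch L3] \/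
    (exists2 f, f \in val L1 & p \in f) /\
    exists e, [/\ e \in val L2, e \in val L3 & p \notin e].
  move=> L23; have [h|hf] := missesP p L1.
    left; have [a aP] := pinned_some p L23.
    by apply: (radon_split_star (a := a)); [apply: pinned_misses|].
  have [h|[e e2 e3]] := commonP L2 L3.
    left; apply: (radon_split_star (a := p)); first exact: pinned_pt_ch.
    exact: pinned_disjoint.
  have [pe|pe] := boolP (p \in e); last by right; split=> //; exists e.
  left; apply: (radon_split_star (a := p)); first exact: pinned_pt_ch.
  exact: (pinned_common_edge L23 e2 e3).
have [//|[[f1 f1G pf1] [e1 [e1H e1K pe1]]]] := easy G H K HK.
have [h|[[f2 f2H pf2] [e2 [e2G e2K pe2]]]] := easy H G K GK.
  by reorder [:: pt p; ch H; ch G; ch K].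
have [h|[[f3 f3K pf3] [e3 [e3G e3H pe3]]]] := easy K G H GH.
  by reorder [:: pt p; ch K; ch G; ch H].
have other L f e e' : f \in val L -> e \in val L -> e' \in val L ->
    p \in f -> p \notin e -> p \notin e' -> e = e'.
  move=> fL eL e'L pf pe pe'.
  have fe : f != e by apply: contraNneq pe => <-.
  by case: (edge_cover (valP L) fL eL fe e'L) => // e'f; rewrite e'f pf in pe'.
have E12 : e1 = e2 by apply: (other K f3).
have E13 : e1 = e3 by apply: (other H f2).
have e1G : e1 \in val G by rewrite E12.
exact: (split_concurrent _ GH GK HK e1G e1H e1K pe1 f1G f2H f3K pf1 pf2 pf3).
Qed.

Lemma split_ssss a b c d : b != c -> b != d -> c != d ->
  radon_split [:: st a; st b; st c; st d].
Proof.
move=> bc bd cd; apply: radon_split13_star => [S|S S2]; first exact: big_st.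
move=> /(star_mem S2) bS /(star_mem S2) cS /(star_mem S2) dS.
by have := card_gt2 bc bd cd bS cS dS; rewrite S2.
Qed.

Lemma split_sssc a b c G : a != b -> a != c -> b != c ->
  radon_split [:: st a; st b; st c; ch G].
Proof.
move=> ab ac bc.
have absent x y : y != c -> [set y; c] \notin val G ->
    radon_split [:: st x; st y; st c; ch G].
  move=> yc h; apply: radon_split13_star => [S|S S2]; first exact: big_ch.
  move=> /(star_mem S2) yS /(star_mem S2) cS /(chords_mem S2) SG.
  by case/negP: h; rewrite -(edge_set2 S2 yc yS cS).
have [bcG|bcG] := boolP ([set b; c] \in val G); last exact: absent.
reorder [:: st b; st a; st c; ch G]; apply: absent => //; apply/negP => acG.
have : [set b; c] = [set a; c].
  by apply: (edge_inj (valP G) bcG acG (x := c)); rewrite !inE eqxx orbT.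
by move/setP/(_ a); rewrite !inE eqxx (negPf ab) (negPf ac).
Qed.

Lemma split_sscc a b G H : G != H ->
  radon_split [:: st a; st b; ch G; ch H].
Proof.
move=> GH.
have [h|[e eG eH]] := commonP G H.
  apply: radon_split13_star => [S|S S2 _]; first exact: big_ch.
  move=> /(chords_mem S2) SG /(chords_mem S2) SH.
  by have := in_set0 S; rewrite -h inE SG SH.
have eE S : S \in val G -> S \in val H -> S = e.
  by move=> SG SH; apply: (common_edge (valP G) (valP H)); rewrite ?(inj_eq val_inj).
have [be|be] := boolP (b \in e).
  reorder [:: st b; st a; ch G; ch H].
  apply: radon_split13_star => [S|S S2 _]; first exact: big_ch.
  by move=> /(chords_mem S2) SG /(chords_mem S2) SH; rewrite (eE S).
apply: radon_split13_star => [S|S S2]; first exact: big_ch.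
move=> /(star_mem S2) bS /(chords_mem S2) SG /(chords_mem S2) SH.
by rewrite (eE S) // in bS; rewrite bS in be.
Qed.

(** The star of [a] is the witness unless the matchings share an edge [e] avoiding [a]. A matching
    that misses [a] can then be paired with the star; if none does, the edges at [a] form the
    concurrent case. *)
Lemma split_sccc a G H K : G != H -> G != K -> H != K ->
  radon_split [:: st a; ch G; ch H; ch K].
Proof.
move=> GH GK HK.
have [/exists_inP[e]|/exists_inPn h] :=
  boolP [exists e in val G :&: val H :&: val K, a \notin e]; last first.
  apply: radon_split13_star => [S|S S2]; first exact: big_ch.
  move=> /(chords_mem S2) SG /(chords_mem S2) SH /(chords_mem S2) SK.
  by apply/negPn/h; rewrite !inE SG SH.
rewrite !inE -andbA => /and3P[eG eH eK] ae.
have avoid L1 L2 L3 : L2 != L3 -> e \in val L2 -> e \in val L3 ->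
    misses a L1 -> radon_split [:: st a; ch L1; ch L2; ch L3].
  move=> L23 e2 e3 h; have /card_gt0P[x xe] : 0 < #|e|.
    by rewrite (card_edge (valP L2) e2).
  apply: (radon_split_star (a := x)); last exact: pinned_common_edge L23 e2 e3 xe.
  by apply: pinned_ch => f fL /(star_mem (card_edge (valP L1) fL)); rewrite (negPf (h f fL)).
have [h|[f1 f1G af1]] := missesP a G; first exact: avoid.
have [h|[f2 f2H af2]] := missesP a H.
  by reorder [:: st a; ch H; ch G; ch K]; apply: avoid.
have [h|[f3 f3K af3]] := missesP a K.
  by reorder [:: st a; ch K; ch G; ch H]; apply: avoid.
exact: (split_concurrent _ GH GK HK eG eH eK ae f1G f2H f3K af1 af2 af3).
Qed.

Lemma split_cccc G H K L : G != H -> G != K -> G != L -> H != K -> H != L ->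
  K != L -> radon_split [:: ch G; ch H; ch K; ch L].
Proof.
move=> GH GK GL HK HL KL.
have same L1 L2 e f : L1 != L2 -> e \in val L1 -> e \in val L2 ->
    f \in val L1 -> f \in val L2 -> e = f.
  move=> L12 e1 e2 f1 f2.
  by apply: (common_edge (valP L1) (valP L2)); rewrite ?(inj_eq val_inj).
(* A split into two pairs fails only when each pair of matchings shares an edge and the two shared
   edges differ. *)
have easy L1 L2 L3 L4 : L1 != L2 -> L3 != L4 ->
    radon_split [:: ch L1; ch L2; ch L3; ch L4] \/
    exists e f, [/\ e \in val L1, e \in val L2, f \in val L3, f \in val L4 & e != f].
  move=> L12 L34; have [h|[e e1 e2]] := commonP L1 L2.
    have /card_gt0P[e eL] : 0 < #|val L1| by case/and3P: (valP L1) => /eqP->.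
    have /card_gt0P[p _] : 0 < #|e| by rewrite (card_edge (valP L1) eL).
    left; have [a aP] := pinned_some p L34.
    by apply: (radon_split_star (a := a)) => //; apply: pinned_disjoint.
  have /card_gt0P[p pe] : 0 < #|e| by rewrite (card_edge (valP L1) e1).
  have pe12 := pinned_common_edge L12 e1 e2 pe.
  have [h|[f f3 f4]] := commonP L3 L4.
    by left; apply: (radon_split_star pe12); apply: pinned_disjoint.
  have [ef|ef] := eqVneq e f; last by right; exists e, f.
  left; apply: (radon_split_star pe12); apply: (pinned_common_edge L34 f3 f4).
  by rewrite -ef.
have [//|[e12 [e34 [e12G e12H e34K e34L d1]]]] := easy G H K L GH KL.
have [h|[e13 [e24 [e13G e13K e24H e24L d2]]]] := easy G K H L GK HL.
  by reorder [:: ch G; ch K; ch H; ch L].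
have [h|[e14 [e23 [e14G e14L e23H e23K d3]]]] := easy G L H K GL HK.
  by reorder [:: ch G; ch L; ch H; ch K].
exfalso.
(* Two of [f1], [f2], [f3] coincide because [L4] has two edges; the corresponding matchings then
   share this edge as well as [e]. *)
have clash L1 L2 L3 L4 e f1 f2 f3 : L1 != L2 -> L1 != L3 -> L2 != L3 ->
    e \in val L1 -> e \in val L2 -> e \in val L3 ->
    f1 \in val L1 -> f1 \in val L4 -> f2 \in val L2 -> f2 \in val L4 ->
    f3 \in val L3 -> f3 \in val L4 -> e != f1 -> e != f2 -> e != f3 -> False.
  move=> L12 L13 L23 e1 e2 e3 f11 f14 f22 f24 f33 f34 ef1 ef2 ef3.
  have [f12|f12] := eqVneq f1 f2.
    by case/eqP: ef1; apply: (same L1 L2) => //; rewrite f12.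
  case: (edge_cover (valP L4) f14 f24 f12 f34) => f3E; rewrite f3E in f33.
    by case/eqP: ef1; apply: (same L1 L3).
  by case/eqP: ef2; apply: (same L2 L3).
(* The two edges of [G] force a coincidence among [e12], [e13], [e14], which yields an edge common
   to three matchings. *)
have [E|d] := eqVneq e12 e13.
  have E' : e12 = e23 by apply: (same H K) => //; rewrite E.
  apply: (clash G H K L e12 e14 e24 e34) => //; first by rewrite E.
    by rewrite E' eq_sym.
  by rewrite E.
have [E|E] := edge_cover (valP G) e12G e13G d e14G.
  have E' : e12 = e24 by apply: (same H L) => //; rewrite -E.
  apply: (clash G H L K e12 e13 e23 e34) => //; first by rewrite -E.
    by rewrite -E.
have E' : e13 = e34 by apply: (same K L) => //; rewrite -E.
apply: (clash G K L H e13 e12 e23 e24) => //; first by rewrite -E.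
- by rewrite eq_sym.
- by rewrite -E.
Qed.

(** * Every four distinct points split *)

Definition rank (u : carrier) : nat :=
  match u with inl (inl _) => 0 | inl (inr _) => 1 | inr _ => 2 end.

(** Sorting by kind leaves 15 of the 81 patterns, one for each of the preceding case lemmas. *)
Lemma radon_split4 (s : seq carrier) : uniq s -> size s = 4 -> radon_split s.
Proof.
pose le (u v : carrier) := rank u <= rank v.
have le_total : total le by move=> u v; apply: leq_total.
move=> us s4; apply: (@radon_split_perm (sort le s)); first by rewrite perm_sort.
have {us s4} : [/\ uniq (sort le s), size (sort le s) = 4 & sorted le (sort le s)].
  by rewrite sort_uniq size_sort sort_sorted.
case: (sort le s) => [|A [|B [|C [|D [|E t]]]]] [] //.
rewrite /= !inE !negb_or !andbT -!andbA => /and5P[AB AC AD BC /andP[BD CD]] _.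
rewrite /le => /and3P[].
have neq_pt p q : pt p != pt q -> p != q by apply: contraNneq => ->.
have neq_st p q : st p != st q -> p != q by apply: contraNneq => ->.
have neq_ch G H : ch G != ch H -> G != H by apply: contraNneq => ->.
move: A B C D AB AC AD BC BD CD.
move=> [[p|a]|G] [[q|b]|H] [[r|c]|K] [[t|d]|L] AB AC AD BC BD CD //= _ _ _;
  [apply: split_pppp|apply: split_ppps|apply: split_pppc|apply: split_ppss
  |apply: split_ppsc|apply: split_ppcc|apply: split_psss|apply: split_pssc
  |apply: split_pscc|apply: split_pccc|apply: split_ssss|apply: split_sssc
  |apply: split_sscc|apply: split_sccc|apply: split_cccc];
  by [apply: neq_pt|apply: neq_st|apply: neq_ch].
Qed.

(** * Families without [k] disjoint members *)

Lemma fam_gt0 u S : S \in fam u -> 0 < #|S|.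
Proof.
case: u => [[p|a]|G]; [|by move/big_st/ltnW|by move/big_ch/ltnW].
by rewrite fam_pt => pS; apply/card_gt0P; exists p.
Qed.

Lemma chord_meets e S : 0 < #|e| -> chord e S -> ~~ [disjoint e & S].
Proof.
move=> /card_gt0P[x xe] h; apply/pred0Pn.
case/orP: h => [/subsetP eS|]; first by exists x; rewrite /= xe eS.
by case/andP=> _ /exists_inP[v ve /exists_inP[w _ /andP[vS _]]]; exists v; rewrite /= ve.
Qed.

(** Double counting: each [x] lies in at most one of the sets. *)
Lemma sum_card_disjoint k (F : 'I_k -> {set 'I_n}) :
  (forall i j, i != j -> [disjoint F i & F j]) -> \sum_i #|F i| <= n.
Proof.
move=> dF; have -> : \sum_i #|F i| = \sum_(x < n) \sum_(i < k) (x \in F i : nat).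
  rewrite exchange_big; apply: eq_bigr => i _.
  by rewrite -sum1_card big_mkcond; apply: eq_bigr => x _; case: (x \in F i).
rewrite -[leqRHS]card_ord -sum1_card; apply: leq_sum => x _.
have [i xi|h] := pickP (fun i => x \in F i); last by rewrite big1 // => i _; rewrite h.
rewrite (bigD1 i) //= xi big1 // => j ji.
by have /disjointFl -> := dF _ _ ji.
Qed.

Lemma fam_matching u k (F : 'I_k -> {set 'I_n}) : 2 < k -> n.+2 <= 3 * k ->
  (forall i, F i \in fam u) -> (forall i j, i != j -> [disjoint F i & F j]) -> False.
Proof.
move=> k2 nk Fu dF.
pose D := [set i | #|F i| == 2].
have i0 : 'I_k by exists 0; apply: ltn_trans k2.
(* An extra unit for each pair makes every set of size at least 2 weigh at least 3, while the total
   weight is at most [n + #|D|] with [n <= 3 * k - 2]. *)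
have FD : 3 * k <= \sum_i (#|F i| + (i \in D)) -> 1 < #|D|.
  have -> : \sum_i (#|F i| + (i \in D)) = \sum_i #|F i| + #|D|.
    rewrite big_split /=; congr (_ + _).
    by rewrite -sum1_card [RHS]big_mkcond; apply: eq_bigr => i _; case: (i \in D).
  move=> h; rewrite -(leq_add2l n) addn2; apply: leq_trans nk (leq_trans h _).
  by rewrite leq_add2r sum_card_disjoint.
have w3 : (forall i, 1 < #|F i|) -> forall i, 3 <= #|F i| + (i \in D).
  by move=> F1 i; move: (F1 i); rewrite inE; case: #|F i| => [|[|[|m]]].
have D1 : (forall i, 1 < #|F i|) -> 1 < #|D|.
  move=> F1; apply: FD; rewrite mulnC -[X in X * 3]card_ord -sum_nat_const.
  by apply: leq_sum => i _; apply: w3.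
have apart i j x : i != j -> x \in F i -> x \in F j -> False.
  by move=> ij xi xj; have /disjointFr/(_ xi) := dF _ _ ij; rewrite xj.
case: u Fu => [[p|a]|G] Fu.
- have ord_k m : m < 3 -> m < k by move=> /leq_trans; apply.
  apply: (apart (Ordinal (ord_k 0 isT)) (Ordinal (ord_k 1 isT)) p) => //.
    by rewrite -fam_pt.
  by rewrite -fam_pt.
- have /card_gt1P[i [j [iD jD ij]]] : 1 < #|D| by apply: D1 => i; apply: big_st (Fu i).
  rewrite !inE in iD jD.
  apply: (apart i j a ij); first by apply: star_mem (Fu i); apply/eqP.
  by apply: star_mem (Fu j); apply/eqP.
- have F1 i : 1 < #|F i| by apply: big_ch (Fu i).
  have injF : {in D &, injective F}.
    move=> i j iD jD Fij; apply/eqP/negPn/negP => ij.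
    have /card_gt0P[x xi] := ltnW (F1 i).
    by apply: (apart i j x ij xi); rewrite -Fij.
  (* The pairs are distinct edges of [G] and there are at least two of them, so both edges occur. *)
  have DG : F @: D = val G.
    apply/eqP; rewrite eqEcard card_in_imset // andbC.
    have -> : #|val G| = 2 by case/and3P: (valP G) => /eqP->.
    rewrite (D1 F1) /=; apply/subsetP => _ /imsetP[i iD ->].
    by apply: chords_mem (Fu i); rewrite inE in iD; apply/eqP.
  have D2 : #|D| = 2.
    by rewrite -(card_in_imset injF) DG; case/and3P: (valP G) => /eqP->.
  have [l lD] : exists l, l \notin D.
    apply/existsP; rewrite -negb_forall; apply/negP => /forallP h.
    suff : #|D| = k by rewrite D2 => k2'; rewrite -k2' in k2.
    by rewrite -[RHS]card_ord; apply: eq_card => i; rewrite h.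
  have Fl3 : #|F l| = 3.
    apply/eqP; rewrite eqn_leq; apply/andP; split; last first.
      by have := w3 F1 l; rewrite (negPf lD) addn0.
    rewrite leqNgt; apply/negP => Fl4.
    (* One set of size at least 4 outside [D] would raise the total weight to [3 * k + 1], too much
       for [#|D| = 2]. So [F l] is a triple and must meet an edge, which is another of the disjoint
       sets. *)
    have : (3 * k).+1 <= n + #|D|.
      apply: leq_trans (_ : \sum_i (#|F i| + (i \in D)) <= _).
        rewrite (bigD1 l) //= (negPf lD) addn0 -addn1.
        have -> : 3 * k + 1 = 4 + 3 * k.-1 by case: (k) k2 => // m _; lia.
        apply: leq_add => //.
        have <- : \sum_(i < k | i != l) 3 = 3 * k.-1.
          by rewrite sum_nat_const mulnC cardC1 card_ord.
        by apply: leq_sum => i _; apply: w3.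
      rewrite big_split /= leq_add ?sum_card_disjoint //.
      rewrite -sum1_card [leqRHS]big_mkcond; apply: leq_sum => i _.
      by case: (i \in D).
    by rewrite D2; lia.
  have := Fu l; rewrite fam_ch inE Fl3 /= => /exists_inP[e].
  rewrite -DG => /imsetP[i iD ->] /(chord_meets (ltnW (F1 i)))/negP[].
  by apply: dF; apply: contraNneq lD => <-.
Qed.

End Points.

(* The convexity space and the upper bound on its second Radon number *)
From mathcomp Require Import all_classical.

Local Open Scope classical_set_scope.
Local Open Scope card_scope.

Lemma card_le_seq (T : eqType) (A : set T) (m : nat) : `I_m #<= A ->
  exists s : seq T, [/\ uniq s, size s = m & forall x, x \in s -> A x].
Proof.
move=> /card_leP[f].
have mI (i : 'I_m) : (i : nat) \in `I_m by rewrite inE /=.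
pose g (i : 'I_m) : T := \val (f (SigSub (mI i))).
have g_inj : injective g.
  move=> i j /val_inj ij; apply: val_inj.
  have := @inj _ _ _ f _ _ _ _ ij; rewrite !inE => /(_ I I) E; exact: (congr1 \val E).
exists [seq g i | i <- enum 'I_m]; split.
- by rewrite map_inj_uniq ?enum_uniq.
- by rewrite size_map size_enum_ord.
- by move=> _ /mapP[i _ ->]; have := valP (f (SigSub (mI i))); rewrite inE.
Qed.

(** No set has [#|T|.+1] points, so the property holds vacuously there and a least value exists. *)
Lemma radon_number_exists (T : finType) (F : set (set T)) (k : nat) :
  exists r : nat, is_radon_number F k r.
Proof.
have ex : exists m, `[< radon_property F k m >].
  exists #|T|.+1; apply/asboolP => P /card_le_seq[s [us ss _]].
  by have := max_card (mem s); rewrite (card_uniqP us) ss ltnn.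
case: (ex_minnP ex) => r /asboolP hr rmin; exists r; split=> // m hm.
by apply: rmin; apply/asboolP.
Qed.

(** Convex sets are described by the conditions [SS] that they impose on families, so intersecting
    them amounts to collecting conditions. *)
Definition chord_space (n : nat) : set (set (carrier n)) :=
  [set A | exists SS : set {set 'I_n},
    A = [set u | forall S, SS S -> S \in fam u]].

Lemma chord_space_convexity (n : nat) : convexity_space (@chord_space n).
Proof.
split.
(* No family contains the empty set, so this condition has no solution. *)
- exists [set finset.set0]; apply/seteqP; split=> // u h.
  by have := fam_gt0 (h finset.set0 erefl); rewrite cards0.
- by exists set0; apply/seteqP; split=> u /= _.
- move=> G GF; exists [set S | exists2 A, G A & forall u, A u -> S \in fam u].
  apply/seteqP; split=> u h.
    by move=> S [A GA]; apply; apply: h.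
  move=> A GA; have [SS ASS] := GF A GA; rewrite ASS => S SSS.
  by apply: h; exists A => // t; rewrite ASS; apply.
Qed.

Lemma conv_chordP (n : nat) (A : set (carrier n)) (u : carrier n) :
  conv (@chord_space n) A u <->
  forall S, (forall t, A t -> S \in fam t) -> S \in fam u.
Proof.
split=> [h S AS|h B [[SS ->] AB] S SSS].
  have := h [set t | forall S', [set S] S' -> S' \in fam t]; apply=> //.
  by split; [exists [set S]|move=> t At _ ->; apply: AS].
by apply: h => t /AB; apply.
Qed.

Lemma chord_space_radon2 (n : nat) : radon_property (@chord_space n) 2 4.
Proof.
move=> P /card_le_seq[s [us s4 sP]].
have [u [s1 [s2 [ps s1n s2n h]]]] := radon_split4 us s4.
have s12P x : x \in s1 ++ s2 -> P x by rewrite (perm_mem ps); apply: sP.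
(* Points of [P] beyond the chosen four join the second part, which can only enlarge its hull. *)
pose Q (i : 'I_2) := if i == ord0 then [set x | x \in s1] else P `\` [set x | x \in s1].
have Q2 x : x \in s2 -> Q ord_max x.
  move=> xs2; split; first by apply: s12P; rewrite mem_cat xs2 orbT.
  move=> /= xs1; have := us; rewrite -(perm_uniq ps) cat_uniq => /and3P[_ /hasP[]].
  by exists x.
have ord2 (i : 'I_2) : i = ord0 \/ i = ord_max.
  by case: i => [[|[|//]] ?]; [left|right]; apply: val_inj.
exists Q; split; first split.
- apply/seteqP; split=> x.
    case=> i _; rewrite /Q; case: ifP => _ => [xs1|[]//].
    by apply: s12P; rewrite mem_cat xs1.
  move=> Px; have [xs1|xs1] := boolP (x \in s1); first by exists ord0.
  by exists ord_max => //; split=> //; apply/negP.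
- move=> i j _ _ [x []].
  case: (ord2 i) => ->; case: (ord2 j) => -> //.
    by move=> x1 [_ /(_ x1)].
  by case=> _ x1 /x1.
- move=> i _; case: (ord2 i) => ->.
    have [x xs1] : exists x, x \in s1.
      by case: (s1) s1n => // x t _; exists x; apply: mem_head.
    by exists x.
  have [x xs2] : exists x, x \in s2.
    by case: (s2) s2n => // x t _; exists x; apply: mem_head.
  by exists x; apply: Q2.
- exists u => i _; apply/conv_chordP => S hS; apply: h.
  case: (ord2 i) hS => -> hS; apply/orP; [left|right]; apply/allP => x xs; apply: hS => //.
  exact: Q2.
Qed.

(** * Lower bounds from the points of the ground set *)

Definition ground (n j : nat) : set (carrier n.+1) :=
  [set inl (inl p) | p in [set p : 'I_n.+1 | p < j]].

Lemma card_ground (n m j : nat) : j <= n.+1 -> m <= j -> `I_m #<= @ground n j.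
Proof.
move=> jn mj; suff [f] : $|{injfun `I_m >-> @ground n j}| by exact: inj_card_le f.
apply/injfunPex; exists (fun i => inl (inl (inord i))) => [i /= im|i i'].
  by exists (inord i) => //=; rewrite inordK; lia.
rewrite !inE /= => im im' [] /(congr1 val) /=.
by rewrite !inordK //; lia.
Qed.

(** With [F i] the set of points in [Q i], [F i] belongs to the family of each of these points,
    hence to that of every [u] in their hull. *)
Lemma ground_parts (n k j : nat) (Q : 'I_k -> set (carrier n.+1)) :
  classical_sets.partition [set: 'I_k] Q (@ground n j) ->
  \bigcap_(i in [set: 'I_k]) conv (@chord_space n.+1) (Q i) !=set0 ->
  exists (u : carrier n.+1) (F : 'I_k -> {set 'I_n.+1}),
    [/\ forall i, F i \in fam u, forall i, F i \subset [set p : 'I_n.+1 | p < j]%SET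
      & forall i i', i != i' -> [disjoint F i & F i']%bool].
Proof.
move=> [cQ tQ _] [u hu]; exists u.
pose F i := [set p : 'I_n.+1 | `[< Q i (inl (inl p)) >]]%SET; exists F.
have Qg i t : Q i t -> exists2 p : 'I_n.+1, p < j & inl (inl p) = t.
  by move=> Qt; have : @ground n j t by rewrite -cQ; exists i.
split.
- move=> i; have /conv_chordP := hu i I; apply=> t Qt.
  by have [p _ pt] := Qg _ _ Qt; rewrite -pt fam_pt inE; apply/asboolP; rewrite pt.
- move=> i; apply/fintype.subsetP => p; rewrite !inE => /Qg[q qj [<-]].
  exact: qj.
- move=> i i' ii'; apply/pred0P => p /=; apply/negbTE/negP; rewrite !inE.
  move=> /andP[p1 p2]; case/eqP: ii'.
  by apply: (tQ i i' I I); exists (inl (inl p)); split; apply/asboolP.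
Qed.

Lemma card_ltn_ord (n j : nat) : #|[set p : 'I_n | p < j]%SET| <= j.
Proof.
rewrite cardE -(size_map val) -[leqRHS](size_iota 0).
apply: uniq_leq_size; first by rewrite map_inj_uniq ?enum_uniq //; apply: val_inj.
by move=> x /mapP[p]; rewrite mem_enum finset.in_set => pj ->; rewrite mem_iota.
Qed.

(** Three points cannot be split: a star or a matching would need two disjoint sets of size at least
    2 among them, and a point would lie in two disjoint sets. *)
Lemma chord_space_radon2_ge (n m : nat) : 2 <= n ->
  radon_property (@chord_space n.+1) 2 m -> 4 <= m.
Proof.
move=> n2 h; rewrite leqNgt; apply/negP => m4.
have [Q [pQ cQ]] := h (@ground n 3) (card_ground (n := n) (j := 3) n2 m4).
have [u [F [Fu Fs dF]]] := ground_parts pQ cQ.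
have d01 : [disjoint F ord0 & F ord_max]%bool by apply: dF.
have small : (forall i, 1 < #|F i|) -> False.
  move=> F1; have sub : (F ord0 :|: F ord_max \subset [set p : 'I_n.+1 | p < 3])%SET.
    by rewrite finset.subUset !Fs.
  have := leq_trans (subset_leq_card sub) (card_ltn_ord n.+1 3).
  rewrite finset.cardsU finset.disjoint_setI0 // cards0 subn0.
  by move/(leq_trans (leq_add (F1 ord0) (F1 ord_max))).
case: u Fu => [[p|a]|G] Fu.
- have p0 := Fu ord0; have p1 := Fu ord_max; rewrite !fam_pt in p0 p1.
  by have := disjointFr d01 p0; rewrite p1.
- by apply: small => i; apply: big_st (Fu i).
- by apply: small => i; apply: big_ch (Fu i).
Qed.

Lemma chord_space_radon_ge (n k m : nat) : 2 < k -> n.+3 <= 3 * k ->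
  radon_property (@chord_space n.+1) k m -> n.+2 <= m.
Proof.
move=> k2 nk h; rewrite leqNgt; apply/negP => mn.
have [Q [pQ cQ]] := h (@ground n n.+1) (card_ground (leqnn n.+1) (mn : m <= n.+1)).
have [u [F [Fu _ dF]]] := ground_parts pQ cQ.
exact: fam_matching k2 nk Fu dF.
Qed.

Theorem theorem2 : forall k : nat, 3 <= k ->
  exists (X : Type) (F : set (set X)),
    [/\ convexity_space F, is_radon_number F 2 4
      & exists r : nat, is_radon_number F k r /\ 3 * (k - 1) + 2 <= r].
Proof.
(* The ground set ['I_n.+1] has [3 * (k - 1) + 1] points, the largest size for which [fam_matching]
   applies. *)
move=> k k3; pose n := 3 * (k - 1).
have nk : n.+3 <= 3 * k by rewrite /n; lia.
have n2 : 2 <= n by rewrite /n; lia.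
exists (carrier n.+1), (@chord_space n.+1); split.
- exact: chord_space_convexity.
- by split=> [|m]; [exact: chord_space_radon2|exact: chord_space_radon2_ge].
- have [r hr] := radon_number_exists (@chord_space n.+1) k.
  exists r; split=> //; rewrite addn2.
  exact: chord_space_radon_ge k3 nk hr.1.
Qed.
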